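(* Let $\mathcal{X}$ be a convex subset of $L^0_c$, and let $\mathcal{C}\subseteq\mathcal{X}$ be a non-empty $\mathcal{P}$-sensitive set with reduction set $\mathcal{Q}\subseteq\mathfrak{P}_c(\Omega)$. For $Q\in\mathcal{Q}$ let $\mathcal{X}_Q:=j_Q(\mathcal{X})$, $\mathcal{C}_Q:=j_Q(\mathcal{C})$, let $\mathcal{Y}_Q$ be a non-empty set of mappings $l:\mathcal{X}_Q\to\mathbb{R}\cup\{-\infty,\infty\}$, and set $$\mathcal{C}_Q^\circ:=\{l\in\mathcal{Y}_Q:\forall X\in\mathcal{C}_Q\ \ l(X)\le 1\},\qquad \mathcal{C}_Q^{\circ\circ}:=\{X\in\mathcal{X}_Q:\forall l\in\mathcal{C}_Q^\circ\ \ l(X)\le 1\}.$$ Further set $$\mathcal{C}^\circ:=\bigcup_{Q\in\mathcal{Q}}\{l\circ j_Q: l\in\mathcal{C}_Q^\circ\},\qquad \mathcal{C}^{\circ\circ}:=\{X\in\mathcal{X}:\forall h\in\mathcal{C}^\circ\ \ h(X)\le 1\}.$$ Suppose that $\mathcal{C}_Q=\mathcal{C}_Q^{\circ\circ}$ for all $Q\in\mathcal{Q}$. Then $\mathcal{C}=\mathcal{C}^{\circ\circ}$.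
   Context: $(\Omega,\mathcal{F})$ is an arbitrary measurable space, $\mathfrak{P}(\Omega)$ the set of probability measures on it, and $\mathcal{P}\subseteq\mathfrak{P}(\Omega)$ a fixed non-empty set. Put $c[A]:=\sup_{P\in\mathcal{P}}P[A]$, $A\in\mathcal{F}$. An event $A$ is $\mathcal{P}$-polar if $c[A]=0$; a property holds $\mathcal{P}$-q.s. if it holds outside a $\mathcal{P}$-polar event. $\mathfrak{P}_c(\Omega)$ is the set of $Q\in\mathfrak{P}(\Omega)$ with $Q[N]=0$ for every $\mathcal{P}$-polar $N$. $L^0_c$ is the space of real-valued random variables on $(\Omega,\mathcal{F})$ modulo $\mathcal{P}$-q.s. equality. For $Q\in\mathfrak{P}_c(\Omega)$, $L^0_Q$ denotes random variables modulo $Q$-a.s. equality, and $j_Q:L^0_c\to L^0_Q$ maps the $\mathcal{P}$-q.s. class of $f$ to its $Q$-a.s. class. A set $\mathcal{C}\subseteq L^0_c$ is $\mathcal{P}$-sensitive if $\mathcal{C}=\bigcap_{Q\in\mathfrak{P}_c(\Omega)}j_Q^{-1}(j_Q(\mathcal{C}))$. A non-empty $\mathcal{Q}\subseteq\mathfrak{P}_c(\Omega)$ is a reduction set for $\mathcal{C}$ if $\mathcal{C}=\bigcap_{Q\in\mathcal{Q}}j_Q^{-1}(j_Q(\mathcal{C}))$. *)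

(* Defs.v *)
From HB Require Import structures.
From mathcomp Require Import all_boot all_order all_algebra.
From mathcomp Require Import all_classical all_reals all_analysis.
From mathcomp Require Import measurable_realfun.

Set Implicit Arguments.
Unset Strict Implicit.
Unset Printing Implicit Defensive.

Import Order.TTheory GRing.Theory Num.Theory.
Import numFieldNormedType.Exports.

Local Open Scope classical_set_scope.
Local Open Scope ring_scope.

Section quasi_sure.
Context (d : measure_display) (T : measurableType d) (R : realType).
Implicit Types (P : set (probability T R)) (A N : set T).

(* c[A], a number in [0, 1] when P is nonempty (and 0 when P is empty). *)
Definition capacity P A : R := sup [set fine (p A) | p in P].

Definition polar P N := measurable N /\ capacity P N = 0.

Definition quasi_surely P (E : set T) := exists2 N, polar P N & ~` N `<=` E.

Definition polar_null P : set (probability T R) :=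
  [set Q | forall N, polar P N -> Q N = 0%E].

Lemma polarP P N :
  polar P N <-> measurable N /\ forall p, P p -> p N = 0%E.
Proof.
rewrite /polar /capacity; split=> -[mN h]; split=> //.
- move=> p Pp; have finp : p N \is a fin_num by exact: fin_num_measure.
  apply/eqP; rewrite eq_le measure_ge0 andbT -(fineK finp) lee_fin -h.
  apply: ub_le_sup; last by exists p.
  exists 1 => _ [q Pq <-]; rewrite -lee_fin fineK ?fin_num_measure//.
  exact: probability_le1.
- have [->|/set0P[p Pp]] := eqVneq P set0; first by rewrite image_set0 sup0.
  rewrite (_ : [set _ | _ in _] = [set 0]) ?sup1//.
  by apply/seteqP; split=> [_ [q /h -> <-]//|_ ->]; exists p; rewrite ?h.
Qed.

End quasi_sure.

Section L0c.
Context (d : measure_display) (T : measurableType d) (R : realType).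
Variable P : set (probability T R).
Implicit Types f g h : {mfun T >-> R}.

Lemma quasi_surelyI (E F : set T) :
  quasi_surely P E -> quasi_surely P F -> quasi_surely P (E `&` F).
Proof.
move=> [M /polarP[mM M0] ME] [N /polarP[mN N0] NF]; exists (M `|` N).
  apply/polarP; split; first exact: measurableU.
  by move=> p Pp; rewrite measureU0 //; [exact: M0|exact: N0].
by rewrite setCU; exact: setISS.
Qed.

Lemma quasi_surelyS (E F : set T) :
  E `<=` F -> quasi_surely P E -> quasi_surely P F.
Proof. by move=> EF [N pN NE]; exists N => //; exact: subset_trans EF. Qed.

Lemma quasi_surelyT (E : set T) : (forall x, E x) -> quasi_surely P E.
Proof. by move=> E1; exists set0 => //; apply/polarP; split. Qed.

Definition qs_eq f g : bool := `[< quasi_surely P [set x | f x = g x] >].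

Lemma qs_eq_refl : reflexive qs_eq.
Proof. by move=> f; apply/asboolP/quasi_surelyT. Qed.

Lemma qs_eq_sym : symmetric qs_eq.
Proof.
suff h f g : qs_eq f g -> qs_eq g f by move=> f g; apply/idP/idP; exact: h.
by move=> /asboolP fg; apply/asboolP; apply: quasi_surelyS fg => x /= ->.
Qed.

Lemma qs_eq_trans : transitive qs_eq.
Proof.
move=> g f h /asboolP fg /asboolP gh; apply/asboolP.
by apply: quasi_surelyS (quasi_surelyI fg gh) => x /= [-> ->].
Qed.

Canonical qs_eq_equiv := EquivRel qs_eq qs_eq_refl qs_eq_sym qs_eq_trans.

Local Open Scope quotient_scope.

Definition L0c : Type := {eq_quot qs_eq}.
HB.instance Definition _ := Choice.on L0c.
HB.instance Definition _ := EqQuotient.on L0c.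

Lemma L0c_eqP f g :
  (\pi_L0c f = \pi_L0c g) <-> quasi_surely P [set x | f x = g x].
Proof.
by split=> [/eqP|fg]; [rewrite eqmodE => /asboolP
                      |apply/eqP; rewrite eqmodE; apply/asboolP].
Qed.

Lemma L0c_repr f : quasi_surely P [set x | repr (\pi_L0c f) x = f x].
Proof. by apply/L0c_eqP; rewrite reprK. Qed.

Lemma L0c_piP (X : L0c) : exists f, X = \pi_L0c f.
Proof. by exists (repr X); rewrite reprK. Qed.

Let zero : L0c := \pi_L0c 0.
Let opp (X : L0c) : L0c := \pi_L0c (- repr X).
Let add (X Y : L0c) : L0c := \pi_L0c (repr X + repr Y).
Let scale (a : R) (X : L0c) : L0c := \pi_L0c (a *: repr X).

Let oppE f : opp (\pi_L0c f) = \pi_L0c (- f).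
Proof.
apply/L0c_eqP; apply: quasi_surelyS (L0c_repr f) => x /= fx.
exact: (congr1 -%R fx).
Qed.

Let addE f g : add (\pi_L0c f) (\pi_L0c g) = \pi_L0c (f + g).
Proof.
apply/L0c_eqP; apply: quasi_surelyS (quasi_surelyI (L0c_repr f) (L0c_repr g)).
by move=> x /= [fx gx]; exact: (congr2 +%R fx gx).
Qed.

Let scaleE a f : scale a (\pi_L0c f) = \pi_L0c (a *: f).
Proof.
apply/L0c_eqP; apply: quasi_surelyS (L0c_repr f) => x /= fx.
exact: (congr1 ( *%R a) fx).
Qed.

Let addA : associative add.
Proof.
move=> X Y Z; have [f ->] := L0c_piP X.
have [g ->] := L0c_piP Y; have [h ->] := L0c_piP Z.
by rewrite !addE addrA.
Qed.

Let addC : commutative add.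
Proof. move=> X Y; have [f ->] := L0c_piP X; have [g ->] := L0c_piP Y.
by rewrite !addE addrC. Qed.

Let add0 : left_id zero add.
Proof. by move=> X; have [f ->] := L0c_piP X; rewrite addE add0r. Qed.

Let addN : left_inverse zero opp add.
Proof. by move=> X; have [f ->] := L0c_piP X; rewrite oppE addE addNr. Qed.

HB.instance Definition _ := GRing.isZmodule.Build L0c addA addC add0 addN.

Let scaleA a b X : scale a (scale b X) = scale (a * b) X.
Proof. by have [f ->] := L0c_piP X; rewrite !scaleE scalerA. Qed.

Let scale1 : left_id 1 scale.
Proof. by move=> X; have [f ->] := L0c_piP X; rewrite scaleE scale1r. Qed.

Let scaleDr : right_distributive scale +%R.
Proof.
move=> a X Y; have [f ->] := L0c_piP X; have [g ->] := L0c_piP Y.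
by rewrite [_ + _]addE !scaleE [RHS]addE scalerDr.
Qed.

Let scaleDl X : {morph scale^~ X : a b / a + b}.
Proof.
by move=> a b; have [f ->] := L0c_piP X; rewrite !scaleE [RHS]addE scalerDl.
Qed.

HB.instance Definition _ :=
  GRing.Zmodule_isLmodule.Build R L0c scaleA scale1 scaleDr scaleDl.

Lemma L0c_piD f g : \pi_L0c (f + g) = \pi_L0c f + \pi_L0c g.
Proof. by rewrite -addE. Qed.

Lemma L0c_piZ a f : \pi_L0c (a *: f) = a *: \pi_L0c f.
Proof. by rewrite -scaleE. Qed.

End L0c.

Section projection.
Context (d : measure_display) (T : measurableType d) (R : realType).
Variable P : set (probability T R).
Implicit Types (Q : probability T R) (C : set (L0c P)).

Local Open Scope quotient_scope.

(* The map j_Q, through the chosen representative of a class: by j_classE it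
   does not depend on that choice when Q is in polar_null P, and it is only
   meaningful for such Q. *)
Definition j_class Q (X : L0c P) : {mfun_ Q, T >-> R} :=
  \pi_({mfun_ Q, T >-> R}) (repr X).

Lemma j_classE Q (f : {mfun T >-> R}) : polar_null P Q ->
  j_class Q (\pi_(L0c P) f) = \pi_({mfun_ Q, T >-> R}) f.
Proof.
move=> PQ; apply/eqP; rewrite eqmodE; apply/asboolP.
have [N pN NE] := L0c_repr P f; exists N; split.
- by case: pN.
- exact: PQ.
- by apply: subsetCl => x /NE /= fx _.
Qed.

Definition j_closure (QQ : set (probability T R)) C : set (L0c P) :=
  \bigcap_(Q in QQ) (j_class Q @^-1` (j_class Q @` C)).

Definition sensitive C := C = j_closure (polar_null P) C.

Definition reduction_set C (QQ : set (probability T R)) :=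
  [/\ QQ !=set0, QQ `<=` polar_null P & C = j_closure QQ C].

Lemma j_res_subproof Q (XX : set (L0c P)) (X : XX) :
  j_class Q (\val X) \in j_class Q @` XX.
Proof. by apply/mem_set; exists (\val X) => //; exact: set_valP. Qed.

(* j_Q as a map from XX to XX_Q = j_Q(XX), so that it can be composed with
   functions that are only defined on XX_Q. *)
Definition j_res Q (XX : set (L0c P)) (X : XX) : j_class Q @` XX :=
  SigSub (j_res_subproof Q X).

End projection.

Section polars.
Context (R : realType) (E : Type) (D : set E).

(* Functions "D -> \bar R" are functions on the subtype of elements of D. *)
Definition polar_of (Y : set (D -> \bar R)) (C : set E) : set (D -> \bar R) :=
  [set l | Y l /\ forall X : D, C (\val X) -> (l X <= 1)%E].

Definition prepolar (H : set (D -> \bar R)) : set E :=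
  [set \val X | X in [set X : D | forall l, H l -> (l X <= 1)%E]].

End polars.

Section global_polar.
Context (d : measure_display) (T : measurableType d) (R : realType).
Variable P : set (probability T R).

Definition global_polar (XX C : set (L0c P)) (QQ : set (probability T R))
    (Y : forall Q, set ((j_class Q @` XX) -> \bar R)) : set (XX -> \bar R) :=
  \bigcup_(Q in QQ)
    [set l \o @j_res _ _ _ _ Q XX | l in polar_of (Y Q) (j_class Q @` C)].

End global_polar.

(* Main.v *)
Require Import Defs.
From mathcomp Require Import all_boot all_order all_algebra.
From mathcomp Require Import all_classical all_reals all_analysis.
From mathcomp Require Import measurable_realfun.
Import Order.TTheory GRing.Theory Num.Theory.
Import numFieldNormedType.Exports.

Local Open Scope classical_set_scope.
Local Open Scope ring_scope.

(** Only the inclusion of the bipolar in [C] uses the hypotheses on [QQ]. For [X] in the bipolar and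
    [Q] in [QQ], each [l] in the polar of [j_Q(C)] pulls back to [l \o j_Q] in the global polar, so
    [l] is at most 1 at [j_Q(X)]. The bipolar identity at [Q] puts [j_Q(X)] in [j_Q(C)], and the
    reduction set recovers [X] in [C] from these memberships. *)

Theorem theorem3p7 (d : measure_display) (T : measurableType d) (R : realType)
    (P : set (probability T R)) (P_neq0 : P !=set0)
    (XX : set (convex_lmodType (L0c P))) (XX_convex : convex_set XX)
    (C : set (L0c P)) (C_sub : C `<=` XX) (C_neq0 : C !=set0)
    (C_sensitive : sensitive C)
    (QQ : set (probability T R)) (QQ_reduction : reduction_set C QQ)
    (Y : forall Q : probability T R, set ((j_class Q @` XX) -> \bar R))
    (Y_neq0 : forall Q, QQ Q -> Y Q !=set0)
    (bipolar_Q : forall Q, QQ Q ->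
      j_class Q @` C = prepolar (polar_of (Y Q) (j_class Q @` C))) :
  C = prepolar (global_polar C QQ Y).
Proof.
have [_ _ C_closure] := QQ_reduction.
apply/seteqP; split => [X CX | _ [X X_le1 <-]].
  exists (SigSub (mem_set (C_sub _ CX))) => // _ [Q _ [l [_ l_le1] <-]].
  by apply: l_le1; exists X.
rewrite C_closure => Q QQ_Q.
suff : (j_class Q @` C) (j_class Q (\val X)) by [].
rewrite (bipolar_Q Q QQ_Q).
(* The value underlying [j_res Q X] is [j_class Q (\val X)] by conversion. *)
exists (j_res Q X) => // l Cl.
by apply: (X_le1 (l \o @j_res _ _ _ _ Q XX)); exists Q => //; exists l.
Qed.
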